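(* Let $(\mathcal{A},\mu,\alpha,B)$ be a quadratic Hom-Novikov algebra and let $(\mathcal{A},[\cdot,\cdot],\alpha)$ be its sub-adjacent Hom-Lie algebra, where $[x,y]=\mu(x,y)-\mu(y,x)$. If $\alpha$ is an automorphism satisfying $B(\alpha(x),y)=B(x,\alpha(y))$ for all $x,y\in\mathcal{A}$, then $(\mathcal{A},[\cdot,\cdot],\alpha,B_\alpha)$ is a quadratic Hom-Lie algebra, where $B_\alpha(x,y)=B(\alpha(x),y)$ for all $x,y\in\mathcal{A}$.
   Context: All vector spaces are over a field $\mathbb{F}$ of characteristic zero. A Hom-Novikov algebra is a triple $(\mathcal{A},\mu,\alpha)$ consisting of a vector space $\mathcal{A}$, a bilinear map $\mu:\mathcal{A}\times\mathcal{A}\to\mathcal{A}$, $\mu(x,y)=xy$, and an algebra homomorphism $\alpha:\mathcal{A}\to\mathcal{A}$ (linear with $\alpha(xy)=\alpha(x)\alpha(y)$) such that for all $x,y,z\in\mathcal{A}$: $(xy)\alpha(z)=(xz)\alpha(y)$ and $(xy)\alpha(z)-\alpha(x)(yz)=(yx)\alpha(z)-\alpha(y)(xz)$. A quadratic Hom-Novikov algebra $(\mathcal{A},\mu,\alpha,B)$ is a Hom-Novikov algebra $(\mathcal{A},\mu,\alpha)$ with a symmetric nondegenerate bilinear form $B:\mathcal{A}\times\mathcal{A}\to\mathbb{F}$ satisfying $B(xy,\alpha(z))=B(\alpha(x),yz)$ for all $x,y,z\in\mathcal{A}$. A Hom-Lie algebra is a triple $(L,[\cdot,\cdot],\alpha)$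 with $L$ a vector space, $[\cdot,\cdot]$ bilinear on $L$ and $\alpha:L\to L$ linear, such that $[x,y]=-[y,x]$ and $[[x,y],\alpha(z)]+[[z,x],\alpha(y)]+[[y,z],\alpha(x)]=0$ for all $x,y,z\in L$. For every Hom-Novikov algebra $(\mathcal{A},\mu,\alpha)$, the triple $(\mathcal{A},[\cdot,\cdot],\alpha)$ with the commutator bracket is a Hom-Lie algebra, called the sub-adjacent Hom-Lie algebra. A quadratic Hom-Lie algebra is a quadruple $(L,[\cdot,\cdot],\alpha,B)$ where $(L,[\cdot,\cdot],\alpha)$ is a Hom-Lie algebra and $B$ is a symmetric nondegenerate bilinear form on $L$ that is invariant, i.e. $B([x,y],z)=B(x,[y,z])$, and satisfies $B(\alpha(x),y)=B(x,\alpha(y))$, for all $x,y,z\in L$. *)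

(* Defs.v *)
From mathcomp Require Import all_boot all_algebra.
From mathcomp Require Export sesquilinear.

Set Implicit Arguments.
Unset Strict Implicit.
Unset Printing Implicit Defensive.

Import GRing.Theory.
Local Open Scope ring_scope.

(* Algebraic structures on a vector space A, of arbitrary dimension, are given
   as predicates on raw operations; in particular (bi)linearity is part of
   each predicate, so that a conclusion stated with it includes linearity. *)

Definition bilinear_op (F : fieldType) (A : lmodType F) (mu : A -> A -> A) :
  Prop := bilinear_for *:%R *:%R mu.

Definition bilinear_form (F : fieldType) (A : lmodType F) (B : A -> A -> F) :
  Prop := bilinear_for *%R *%R B.

Record algebra_hom (F : fieldType) (A : lmodType F)
    (mu : A -> A -> A) (alpha : A -> A) : Prop := AlgebraHom {
  algebra_hom_linear : linear alpha;
  algebra_hom_mul : forall x y, alpha (mu x y) = mu (alpha x) (alpha y)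
}.

Record algebra_automorphism (F : fieldType) (A : lmodType F)
    (mu : A -> A -> A) (alpha : A -> A) : Prop := AlgebraAutomorphism {
  automorphism_hom : algebra_hom mu alpha;
  automorphism_bij : bijective alpha
}.

Record hom_novikov (F : fieldType) (A : lmodType F)
    (mu : A -> A -> A) (alpha : A -> A) : Prop := HomNovikov {
  hom_novikov_bilinear : bilinear_op mu;
  hom_novikov_hom : algebra_hom mu alpha;
  hom_novikov_rcomm : forall x y z,
    mu (mu x y) (alpha z) = mu (mu x z) (alpha y);
  hom_novikov_lsym : forall x y z,
    mu (mu x y) (alpha z) - mu (alpha x) (mu y z) =
    mu (mu y x) (alpha z) - mu (alpha y) (mu x z)
}.

(* On a space that need not be finite-dimensional, nondegeneracy means that
   the radical is zero, i.e. that x |-> B x is injective.  B is symmetric, so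
   the left and right radicals agree.  (The library's nondegenerate is only
   defined over a vectType.) *)
Record symmetric_nondegenerate (F : fieldType) (A : lmodType F)
    (B : A -> A -> F) : Prop := SymmetricNondegenerate {
  sym_nondeg_bilinear : bilinear_form B;
  sym_nondeg_sym : forall x y, B x y = B y x;
  sym_nondeg_nondeg : forall x, (forall y, B x y = 0) -> x = 0
}.

Record quadratic_hom_novikov (F : fieldType) (A : lmodType F)
    (mu : A -> A -> A) (alpha : A -> A) (B : A -> A -> F) : Prop :=
  QuadraticHomNovikov {
  qhn_hom_novikov : hom_novikov mu alpha;
  qhn_form : symmetric_nondegenerate B;
  qhn_invariant : forall x y z, B (mu x y) (alpha z) = B (alpha x) (mu y z)
}.

(* alpha is only required to be linear here, not multiplicative. *)
Record hom_lie (F : fieldType) (L : lmodType F)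
    (br : L -> L -> L) (alpha : L -> L) : Prop := HomLie {
  hom_lie_bilinear : bilinear_op br;
  hom_lie_linear : linear alpha;
  hom_lie_skew : forall x y, br x y = - br y x;
  hom_lie_jacobi : forall x y z,
    br (br x y) (alpha z) + br (br z x) (alpha y) + br (br y z) (alpha x) = 0
}.

Record quadratic_hom_lie (F : fieldType) (L : lmodType F)
    (br : L -> L -> L) (alpha : L -> L) (B : L -> L -> F) : Prop :=
  QuadraticHomLie {
  qhl_hom_lie : hom_lie br alpha;
  qhl_form : symmetric_nondegenerate B;
  qhl_invariant : forall x y z, B (br x y) z = B x (br y z);
  qhl_adjoint : forall x y, B (alpha x) y = B x (alpha y)
}.

Definition commutator (F : fieldType) (A : lmodType F) (mu : A -> A -> A) :
  A -> A -> A := fun x y => mu x y - mu y x.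

Definition twisted_form (F : fieldType) (A : lmodType F)
    (alpha : A -> A) (B : A -> A -> F) : A -> A -> F :=
  fun x y => B (alpha x) y.

(* Main.v *)
Require Import Defs.
From mathcomp Require Import all_boot all_algebra.

(** Left symmetry says that the associator of the Hom-product is symmetric in
    its first two arguments; antisymmetrising it over three arguments gives
    the Hom-Jacobi identity for the commutator ([commutator_hom_lie]).

    For the form, self-adjointness of [alpha] turns the hypothesis
    [B (xy, alpha z) = B (alpha x, yz)] into plain associativity of the
    twisted form [B_alpha]: [B_alpha (xy, z) = B_alpha (x, yz)], and it also
    makes [B_alpha] symmetric.  For a symmetric form, associativity makes
    [B_alpha (xy, z)] cyclically invariant in [x], [y], [z], and hence passes to
    the commutator ([commutator_invariant]).  Injectivity of [alpha]
    keeps the form nondegenerate. *)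

Set Implicit Arguments.
Unset Strict Implicit.
Unset Printing Implicit Defensive.

Import GRing.Theory.
Local Open Scope ring_scope.

Lemma bilinear_for_sub (F : fieldType) (U U' : lmodType F) (V : zmodType)
    (s s' : GRing.Scale.law F V) (f : U -> U' -> V) :
  bilinear_for s s' f ->
  (forall x y z, f (x - y) z = f x z - f y z) *
  (forall x y z, f x (y - z) = f x y - f x z).
Proof.
case=> fl fr; split=> x y z.
  exact: (zmod_morphism_linear (fl z)).
exact: (zmod_morphism_linear (fr x)).
Qed.

Lemma commutator_bilinear (F : fieldType) (A : lmodType F) (mu : A -> A -> A) :
  bilinear_op mu -> bilinear_op (commutator mu).
Proof.
case=> mul mur; split=> x c y z; rewrite /commutator /=;
  by rewrite (mul x c y z) (mur x c y z) scalerBr opprD addrACA.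
Qed.

(** Left symmetry trades the two products [(xy) alpha(z)] and [(yx) alpha(z)]
    of each double bracket for products of the shape [alpha(_) (_ _)], and
    the twelve products of that shape cancel in pairs over the cyclic sum. *)
Lemma commutator_hom_lie (F : fieldType) (A : lmodType F)
    (mu : A -> A -> A) (alpha : A -> A) :
  bilinear_op mu -> linear alpha ->
  (forall x y z,
    mu (mu x y) (alpha z) - mu (alpha x) (mu y z) =
    mu (mu y x) (alpha z) - mu (alpha y) (mu x z)) ->
  hom_lie (commutator mu) alpha.
Proof.
move=> mu_bil alpha_lin lsym; have muB := bilinear_for_sub mu_bil.
split=> // [|x y|x y z]; first exact: commutator_bilinear.
  by rewrite /commutator opprB.
have doubleE u v w : commutator mu (commutator mu u v) (alpha w) =
    (mu (alpha u) (mu v w) - mu (alpha v) (mu u w))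
    - (mu (alpha w) (mu u v) - mu (alpha w) (mu v u)).
  rewrite /commutator !muB; congr (_ - _).
  move/eqP: (lsym u v w); rewrite subr_eq => /eqP ->.
  by rewrite -addrA addrC subrKA.
rewrite !doubleE.
move: (mu (alpha x) (mu y z)) (mu (alpha x) (mu z y)) => a a'.
move: (mu (alpha y) (mu z x)) (mu (alpha y) (mu x z)) => b b'.
move: (mu (alpha z) (mu x y)) (mu (alpha z) (mu y x)) => c c'.
(* Regrouped, the sum telescopes through a, b', b, c', c, a', a. *)
rewrite !opprB (AC (2*2*2) ((1*4)*(5*2)*(3*6))) /=.
by rewrite !subrKA subrr.
Qed.

(** Associativity and symmetry give [f (yx, z) = f (y, xz) = f (xz, y) =
    f (x, zy)], which is what the second term of the commutator requires. *)
Lemma commutator_invariant (F : fieldType) (A : lmodType F)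
    (mu : A -> A -> A) (f : A -> A -> F) :
  bilinear_form f -> (forall x y, f x y = f y x) ->
  (forall x y z, f (mu x y) z = f x (mu y z)) ->
  forall x y z, f (commutator mu x y) z = f x (commutator mu y z).
Proof.
move=> f_bil fC fA x y z; rewrite /commutator !(bilinear_for_sub f_bil).
by rewrite fA (fA y) (fC y) fA.
Qed.

Lemma twisted_form_symmetric_nondegenerate (F : fieldType) (A : lmodType F)
    (alpha : A -> A) (B : A -> A -> F) :
  symmetric_nondegenerate B -> linear alpha -> injective alpha ->
  (forall x y, B (alpha x) y = B x (alpha y)) ->
  symmetric_nondegenerate (twisted_form alpha B).
Proof.
case=> [[Bl Br] BC Bnd] alpha_lin alpha_inj adj.
split=> [|x y|x Bx0]; rewrite /twisted_form.
- split=> x c y z; last exact: Br.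
  by rewrite alpha_lin (Bl x c _ _).
- by rewrite adj BC.
have alpha0 : alpha 0 = 0.
  by rewrite -[X in alpha X](subrr 0) (zmod_morphism_linear alpha_lin) subrr.
by apply: alpha_inj; rewrite alpha0; apply: Bnd => y; exact: Bx0.
Qed.

Theorem proposition4p3 (F : fieldType) (char0 : [pchar F] =i pred0)
    (A : lmodType F) (mu : A -> A -> A) (alpha : A -> A) (B : A -> A -> F)
    (hA : quadratic_hom_novikov mu alpha B)
    (alpha_auto : algebra_automorphism mu alpha)
    (alpha_adj : forall x y : A, B (alpha x) y = B x (alpha y)) :
  quadratic_hom_lie (commutator mu) alpha (twisted_form alpha B).
Proof.
case: hA => [[mu_bil [alpha_lin _] _ lsym] B_form B_inv].
have form_tw : symmetric_nondegenerate (twisted_form alpha B).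
  apply: twisted_form_symmetric_nondegenerate => //.
  exact: bij_inj (automorphism_bij alpha_auto).
have [tw_bil tw_sym _] := form_tw.
split=> // [||x y].
- exact: commutator_hom_lie.
- apply: commutator_invariant => // x y z.
  by rewrite /twisted_form alpha_adj B_inv.
by rewrite /twisted_form alpha_adj.
Qed.
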